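(* Every leapfrog fullerene graph is 2-resonant.
   Context: A fullerene graph is a 3-connected plane cubic graph with exactly 12 pentagonal faces and all other faces hexagonal. Leapfrog operation on a fullerene graph $F$: for each face $f$ of $F$, add a new vertex $v_f$ inside $f$ joined to all vertices of $f$, obtaining a plane triangulation $F'$; the leapfrog graph $F^*$ is the geometric dual of $F'$. A leapfrog fullerene graph is a fullerene graph arising from some fullerene graph by this operation. A set $\mathcal H$ of pairwise vertex-disjoint hexagonal faces of a fullerene graph $G$ is a resonant pattern if $G$ has a perfect matching $M$ such that every hexagon in $\mathcal H$ is $M$-alternating (edges alternately in and off $M$), equivalently $G$ minus all vertices of the hexagons of $\mathcal H$ has a perfect matching. $G$ is $k$-resonant if every set of $i$ pairwise disjoint hexagons, for each $0\le i\le k$, is a resonant pattern. *)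

(* Defs.v *)
From HB Require Import structures.
From mathcomp Require Import all_boot all_fingroup.

Set Implicit Arguments.
Unset Strict Implicit.
Unset Printing Implicit Defensive.

(* Plane graphs are encoded by rotation systems.  A dart is an edge with a    *)
(* chosen direction, based at its tail; [edge] reverses a dart and [node]     *)
(* sends it to the next dart counterclockwise around its tail.  Vertices,     *)
(* edges and faces are the orbits of [node], [edge] and [face], as sets of    *)
(* darts.  Graphs with isolated vertices are not represented.                 *)
Record cmap := CMap {
  dart : finType;
  edge : {perm dart};
  node : {perm dart};
  edgeK : involutive edge;
  edge_neq : forall d, edge d != d }.

Section PlaneGraphs.
Variable G : cmap.
Implicit Types (d : dart G) (u v E h : {set dart G}).
Implicit Types (S W M H : {set {set dart G}}).

(* [face d] is the dart after [d] on the boundary walk of the face to the     *)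
(* left of [d]; permutations compose left to right, so this is                *)
(* [node^-1 (edge d)].                                                        *)
Definition face : {perm dart G} := (edge G * (node G)^-1)%g.

Definition vertices : {set {set dart G}} := porbits (node G).
Definition edges : {set {set dart G}} := porbits (edge G).
Definition faces : {set {set dart G}} := porbits face.

Definition adj u v : bool := [exists d in u, edge G d \in v].

Definition connected_on W : Prop :=
  {in W &, forall u v,
    connect [rel x y | [&& x \in W, y \in W & adj x y]] u v}.

(* No loops and no parallel edges. *)
Definition simple_graph : Prop :=
  (forall d, edge G d \notin porbit (node G) d) /\
  (forall d1 d2, d2 \in porbit (node G) d1 ->
     edge G d2 \in porbit (node G) (edge G d1) -> d1 = d2).

Definition k_connected (k : nat) : Prop :=
  k < #|vertices| /\
  forall S, S \subset vertices -> #|S| < k -> connected_on (vertices :\: S).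

Definition cubic : Prop := forall v, v \in vertices -> #|v| = 3.

(* A connected rotation system embeds in the sphere exactly when it satisfies *)
(* Euler's formula.                                                           *)
Definition plane : Prop :=
  connected_on vertices /\ #|vertices| + #|faces| = #|edges| + 2.

(* The cardinality of a face is the length of its boundary walk. *)
Definition fullerene : Prop :=
  [/\ simple_graph, plane, k_connected 3, cubic &
      #|[set h in faces | #|h| == 5]| = 12 /\
      forall h, h \in faces -> #|h| = 5 \/ #|h| = 6].

Definition perfect_matching M : Prop :=
  M \subset edges /\
  forall v, v \in vertices -> #|[set E in M | ~~ [disjoint E & v]]| = 1.

Definition hexagons : {set {set dart G}} := [set h in faces | #|h| == 6].

Definition face_vertices h : {set {set dart G}} := [set porbit (node G) d | d in h].

Definition pairwise_disjoint H : Prop :=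
  {in H &, forall h1 h2, h1 != h2 ->
    [disjoint face_vertices h1 & face_vertices h2]}.

(* Of any two consecutive edges on the boundary of [h], exactly one is in M. *)
Definition alternating M h : Prop :=
  forall d, d \in h ->
    (porbit (edge G) d \in M) = (porbit (edge G) (face d) \notin M).

Definition resonant_pattern H : Prop :=
  exists M, perfect_matching M /\ forall h, h \in H -> alternating M h.

Definition k_resonant (k : nat) : Prop :=
  forall i H, i <= k -> H \subset hexagons -> #|H| = i ->
    pairwise_disjoint H -> resonant_pattern H.

End PlaneGraphs.

(* Isomorphism of plane graphs preserving the orientation of the sphere. *)
Definition cmap_iso (G1 G2 : cmap) : Prop :=
  exists phi : dart G1 -> dart G2,
    [/\ bijective phi,
        forall d, phi (edge G1 d) = edge G2 (phi d) &
        forall d, phi (node G1 d) = node G2 (phi d)].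

(* Geometric dual: the dual of the dart [d] crosses [d] from the face to its  *)
(* left to the face to its right, so the darts based at a dual vertex form an *)
(* orbit of [face].                                                           *)
Definition dual (G : cmap) : cmap :=
  CMap (face G) (@edgeK G) (@edge_neq G).

(* Adding a vertex inside each face, joined to every vertex of that face: for *)
(* each dart [d], lying on the boundary of the face to its left, the corner   *)
(* between [d] and [node d] receives the spoke joining the tail of [d] to the *)
(* new vertex of that face.                                                   *)
Section Stellation.
Variable G : cmap.

Inductive stell_dart :=
  | Old of dart G       (* a dart of G *)
  | Spoke of dart G     (* from the tail of d to the centre of its face *)
  | Centre of dart G.   (* the reverse of [Spoke d] *)

Definition stell_code (x : stell_dart) : dart G + dart G + dart G :=
  match x with
  | Old d => inl (inl d) | Spoke d => inl (inr d) | Centre d => inr d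
  end.
Definition stell_decode (c : dart G + dart G + dart G) : stell_dart :=
  match c with
  | inl (inl d) => Old d | inl (inr d) => Spoke d | inr d => Centre d
  end.
Lemma stell_codeK : cancel stell_code stell_decode.
Proof. by case. Qed.

HB.instance Definition _ := Countable.copy stell_dart (can_type stell_codeK).
HB.instance Definition _ : isFinite stell_dart := CanIsFinite stell_codeK.

Definition stell_edge_fun (x : stell_dart) : stell_dart :=
  match x with
  | Old d => Old (edge G d) | Spoke d => Centre d | Centre d => Spoke d
  end.

Definition stell_node_fun (x : stell_dart) : stell_dart :=
  match x with
  | Old d => Spoke d | Spoke d => Old (node G d) | Centre d => Centre (face G d)
  end.

Lemma stell_edge_funK : involutive stell_edge_fun.
Proof. by case=> d //=; rewrite edgeK. Qed.

Lemma stell_node_fun_inj : injective stell_node_fun.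
Proof. by case=> x [] y //= [] => [->|/perm_inj->|/perm_inj->]. Qed.

Definition stell_edge : {perm stell_dart} := perm (inv_inj stell_edge_funK).
Definition stell_node : {perm stell_dart} := perm stell_node_fun_inj.

Lemma stell_edgeK : involutive stell_edge.
Proof. by move=> x; rewrite !permE stell_edge_funK. Qed.

Lemma stell_edge_neq x : stell_edge x != x.
Proof.
apply/eqP; rewrite permE; case: x => d //= [] /eqP.
by rewrite (negPf (edge_neq d)).
Qed.

Definition stellation : cmap :=
  CMap stell_node stell_edgeK stell_edge_neq.

End Stellation.

Definition leapfrog (F : cmap) : cmap := dual (stellation F).

(* A mirror image of [leapfrog F] is the leapfrog of the mirror image of [F], *)
(* so orientation-preserving isomorphisms suffice.                            *)
Definition leapfrog_fullerene (G : cmap) : Prop :=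
  fullerene G /\ exists F : cmap, fullerene F /\ cmap_iso (leapfrog F) G.

(* Main.v *)
Require Import Defs.
From mathcomp Require Import all_boot all_fingroup.
From mathcomp Require Import all_algebra.

Set Implicit Arguments.
Unset Strict Implicit.
Unset Printing Implicit Defensive.

(* The hexagons of the leapfrog graph F* surround either a vertex or a
   hexagonal face of F, and the duals of the edges of F form a perfect matching
   of F* in which all hexagons around vertices alternate.  For an independent
   set s of vertices of F, switch this matching along the (pairwise disjoint)
   hexagons around the vertices of s: the hexagon around a face alternates when
   s contains every other vertex of that face, and the hexagon around a vertex
   v when s misses v and its neighbours.  It remains to choose s.  By
   planarity and 3-connectivity the dual of F is simple: two faces share at
   most one edge.  Hence two disjoint hexagons cannot be joined by edges of all
   four parity types, since consecutive ones would bound a quadrilateral; for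
   two adjacent hexagons one of the two compatible choices is independent,
   again because F has no quadrilateral; and a vertex off a hexagon has at most
   one neighbour on it, because F has no triangle. *)

(** * Orbits of permutations *)

Section Orbits.
Variable T : finType.
Implicit Type s : {perm T}.

Lemma porbitS s x : porbit s (s x) = porbit s x.
Proof. by have := porbit_perm s 1 x; rewrite expg1. Qed.

Lemma porbit_invariant (U : Type) s (g : T -> U) x y :
  (forall z, g (s z) = g z) -> y \in porbit s x -> g y = g x.
Proof.
move=> gS /porbitP[i ->]; rewrite permX.
by elim: i => //= i <-; rewrite gS.
Qed.

Lemma porbit_conj (T' : finType) (f : T -> T') s (t : {perm T'}) x :
  (forall z, f (s z) = t (f z)) -> porbit t (f x) = f @: porbit s x.
Proof.
move=> fS.
have fX i z : f ((s ^+ i)%g z) = (t ^+ i)%g (f z).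
  by rewrite !permX; elim: i => //= i <-.
apply/setP=> y; apply/porbitP/imsetP => [[i ->]|[z /porbitP[i ->] ->]].
  by exists ((s ^+ i)%g x); rewrite ?fX ?mem_porbit.
by exists i; rewrite fX.
Qed.

(** Numbers the orbits, so that vertices and faces can index the rows of matrices. *)
Lemma porbit_index s :
  exists f : T -> 'I_#|porbits s|,
    (forall x y, (f x == f y) = (x \in porbit s y)) /\
    forall i, exists x, f x = i.
Proof.
have /fin_all_exists[f fE] x : exists i : 'I_#|porbits s|, enum_val i = porbit s x.
  have xP : porbit s x \in porbits s by apply: imset_f.
  by exists (enum_rank_in xP (porbit s x)); rewrite enum_rankK_in.
exists f; split=> [x y|i]; first by rewrite -(inj_eq enum_val_inj) !fE eq_porbit_mem.
have /imsetP[x _ xE] := enum_valP i.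
by exists x; apply: enum_val_inj; rewrite fE.
Qed.

Lemma porbit3 s x :
  #|porbit s x| = 3 -> s (s (s x)) = x /\ uniq [:: x; s x; s (s x)].
Proof. by move=> sx; have := iter_porbit s x; have := uniq_traject_porbit s x; rewrite sx. Qed.

End Orbits.

(** * The Jordan curve property *)

Section Jordan.
Variable G : cmap.
Implicit Types c d : dart G.

Lemma faceE d : face G d = (node G)^-1%g (edge G d).
Proof. exact: permM. Qed.

Lemma node_face d : node G (face G d) = edge G d.
Proof. by rewrite faceE permKV. Qed.

Lemma face_edge d : face G (edge G d) = (node G)^-1%g d.
Proof. by rewrite faceE edgeK. Qed.

Lemma mem_porbit_edge c d : (c \in porbit (edge G) d) = (c == d) || (c == edge G d).
Proof.
apply/idP/orP => [/porbitP[i ->]|].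
  rewrite permX; elim: i => /= [|i [/eqP->|/eqP->]]; rewrite ?edgeK ?eqxx; auto.
by case=> /eqP->; [apply: porbit_id | apply: (mem_porbit _ 1)].
Qed.

Lemma porbit_edgeE d : porbit (edge G) d = [set d; edge G d].
Proof. by apply/setP=> c; rewrite mem_porbit_edge !inE. Qed.

Lemma edge_index d : exists j : 'I_#|edges G|, enum_val j = porbit (edge G) d.
Proof.
have dE : porbit (edge G) d \in edges G by apply: imset_f.
by exists (enum_rank_in dE (porbit (edge G) d)); rewrite enum_rankK_in.
Qed.

Lemma mem_vertices d : porbit (node G) d \in vertices G.
Proof. exact: imset_f. Qed.

(** Induction along a connecting path. This turns connectivity into a statement about functions, the
    form needed for kernels and for cuts. *)
Lemma connected_on_const (U : Type) (W : {set {set dart G}}) (g : dart G -> U) :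
  connected_on W -> W \subset vertices G ->
  (forall d, g (node G d) = g d) ->
  (forall d, porbit (node G) d \in W -> porbit (node G) (edge G d) \in W ->
     g (edge G d) = g d) ->
  forall c d, porbit (node G) c \in W -> porbit (node G) d \in W -> g c = g d.
Proof.
move=> conW /subsetP WV gN gE c d cW dW.
have /connectP[p pP vE] := conW _ _ cW dW.
elim: p c cW pP vE => [|w p IH] c cW /= => [_ /eqP|/andP[/and3P[_ wW]]].
  by rewrite eq_porbit_mem => /(porbit_invariant gN).
case/existsP=> a /andP[ac aw] pP vE.
have wE : w = porbit (node G) (edge G a).
  by have /imsetP[z _ wz] := WV w wW; apply/esym/eqP; move: aw; rewrite wz eq_porbit_mem.
rewrite -(IH (edge G a)) -?wE //.
rewrite -(porbit_invariant gN ac) gE -?wE //.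
by move: ac; rewrite -eq_porbit_mem => /eqP->.
Qed.

Lemma connected_const (U : Type) (g : dart G -> U) :
  connected_on (vertices G) ->
  (forall d, g (node G d) = g d) -> (forall d, g (edge G d) = g d) ->
  forall c d, g c = g d.
Proof.
move=> conG gN gE c d.
by apply: (connected_on_const conG (subxx _) gN) (mem_vertices c) (mem_vertices d) => x _ _.
Qed.

Import GRing.Theory.
Local Open Scope ring_scope.

Lemma sum_edges (V : nmodType) (r : 'I_#|edges G| -> dart G) (q : dart G -> V) :
  (forall j, enum_val j = porbit (edge G) (r j)) ->
  \sum_j (q (r j) + q (edge G (r j))) = \sum_d q d.
Proof.
move=> rE.
rewrite [RHS](partition_big (porbit (edge G)) (fun e => e \in edges G)) /=; last first.
  by move=> d _; apply: imset_f.
rewrite [RHS]big_enum_val; apply: eq_bigr => j _.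
rewrite rE (eq_bigl (mem [set r j; edge G (r j)])); last first.
  by move=> d /=; rewrite eq_porbit_mem porbit_edgeE.
by rewrite big_setU1 ?big_set1 //= inE eq_sym edge_neq.
Qed.

(** With [f] numbering vertices or faces this is the vertex-edge or the face-edge incidence matrix,
    [r] choosing a dart of each edge. In characteristic 2 an edge with the same class on both sides
    gives a zero column. *)
Definition incidence n (f : dart G -> 'I_n) (r : 'I_#|edges G| -> dart G) :
    'M['F_2]_(n, #|edges G|) :=
  \matrix_(i, j) ((f (r j) == i)%:R + (f (edge G (r j)) == i)%:R).

Lemma mul_incidence n (f : dart G -> 'I_n) r (x : 'rV_n) j :
  (x *m incidence f r) 0 j = x 0 (f (r j)) + x 0 (f (edge G (r j))).
Proof.
rewrite mxE; under eq_bigr do rewrite mxE mulrDr.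
rewrite big_split /=; congr (_ + _).
  by rewrite (bigD1 (f (r j))) //= eqxx mulr1 big1 ?addr0 // => i /negPf;
     rewrite eq_sym => ->; rewrite mulr0.
by rewrite (bigD1 (f (edge G (r j)))) //= eqxx mulr1 big1 ?addr0 // => i /negPf;
   rewrite eq_sym => ->; rewrite mulr0.
Qed.

Lemma addF2_eq0 (a b : 'F_2) : (a + b == 0) = (a == b).
Proof. by rewrite addr_eq0 (oppr_pchar2 (pchar_Fp _)). Qed.

(** A row vector in the kernel is a function on classes with equal values at both sides of each
    edge, hence constant; so the kernel is at most a line. *)
Lemma rank_incidence n (f : dart G -> 'I_n) (r : 'I_#|edges G| -> dart G) :
  (forall j, enum_val j = porbit (edge G) (r j)) ->
  (forall i, exists d, f d = i) ->
  (forall x : 'I_n -> 'F_2, (forall d, x (f (edge G d)) = x (f d)) ->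
     forall c d, x (f c) = x (f d)) ->
  (n.-1 <= \rank (incidence f r))%N.
Proof.
move=> rE fS fC.
suff : (\rank (kermx (incidence f r)) <= 1)%N
  by rewrite mxrank_ker; case: n {fS fC} f => [|n] f; rewrite // leq_subLR addn1.
suff /mxrankS/leq_trans-> : (kermx (incidence f r) <= (const_mx 1 : 'rV_n))%MS
  by rewrite ?rank_leq_row.
apply/rV_subP => x /sub_kermxP x0.
have xE d : x 0 (f (edge G d)) = x 0 (f d).
  have [j /eqP] := edge_index d.
  have := mul_incidence f r x j; rewrite x0 mxE rE eq_porbit_mem mem_porbit_edge.
  move=> + /orP[]/eqP rj; rewrite rj ?edgeK => /esym/eqP; rewrite addF2_eq0 => /eqP->//.
have xC := fC (x 0) xE.
have [i _|n0] := pickP (fun _ : 'I_n => true).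
  have [d _] := fS i; apply/sub_rVP; exists (x 0 (f d)); apply/rowP=> k.
  by have [c <-] := fS k; rewrite !mxE mulr1; apply: xC.
by rewrite (_ : x = 0) ?sub0mx //; apply/rowP=> k; have := n0 k.
Qed.

(* Over F_2, a set of edges meeting every face evenly is a cut.  Writing A and
   B for the vertex-edge and face-edge incidence matrices, A B^T = 0, while
   connectedness gives rank A >= V - 1 and rank B >= F - 1; by Euler's formula
   these add up to E, so that the row space of A is the whole kernel of B^T. *)
Lemma even_edges_cut (Y : {set dart G}) :
  plane G -> (forall d, (edge G d \in Y) = (d \in Y)) ->
  (forall d, ~~ odd #|Y :&: porbit (face G) d|) ->
  exists X : dart G -> bool, (forall d, X (node G d) = X d) /\
    forall d, (d \in Y) = X d (+) X (edge G d).
Proof.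
move=> [conG euler] YE Yeven.
have /fin_all_exists[r rE] (j : 'I_#|edges G|) :
    exists d, enum_val j = porbit (edge G) d.
  by have /imsetP[d _ ->] := enum_valP j; exists d.
have [v [vE vS]] := porbit_index (node G).
have [f [fE fS]] := porbit_index (face G).
have vN d : v (node G d) = v d by apply/eqP; rewrite vE -eq_porbit_mem porbitS.
have fF d : f (face G d) = f d by apply/eqP; rewrite fE -eq_porbit_mem porbitS.
have two0 (a : 'F_2) : a + a = 0 by apply/eqP; rewrite addF2_eq0.
set A := incidence v r; set B := incidence f r.
have rkA : (#|vertices G|.-1 <= \rank A)%N.
  apply: rank_incidence rE vS _ => x xE.
  by apply: (@connected_const _ (x \o v)) => //= d; rewrite vN.
have rkB : (#|faces G|.-1 <= \rank B)%N.
  apply: rank_incidence rE fS _ => x xE.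
  apply: (@connected_const _ (x \o f)) => //= d.
  (* Since [node] sends [face c] to [edge c], invariance along faces and across edges gives
     invariance under [node]. *)
  by rewrite -[d in LHS](permKV (face G)) node_face xE -[in LHS]fF permKV.
have ABT : A *m B^T = 0.
  apply/matrixP=> i k; rewrite !mxE.
  pose q d : 'F_2 := (v d == i)%:R * ((f d == k)%:R + (f (edge G d) == k)%:R).
  transitivity (\sum_j (q (r j) + q (edge G (r j)))).
    by apply: eq_bigr => j _; rewrite !mxE mulrDl /q edgeK [X in _ + _ * X]addrC.
  rewrite (sum_edges _ rE) /q; under eq_bigr do rewrite mulrDr.
  (* The entry counts darts at vertex [i] with face [k] on their left or on their right. The face to
     the right of [node d] is the one to the left of [d], so the two counts agree and cancel. *)
  rewrite big_split /= [X in _ + X](reindex_inj (@perm_inj _ (node G))) /=.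
  rewrite [X in _ + X](eq_bigr (fun d => (v d == i)%:R * (f d == k)%:R)) ?two0 // => d _.
  by rewrite vN -(fF (edge G _)) face_edge permK.
pose y : 'rV['F_2]_#|edges G| := \row_j (r j \in Y)%:R.
have yBT : y *m B^T = 0.
  apply/matrixP=> i k; rewrite !mxE.
  pose q d : 'F_2 := (d \in Y)%:R * (f d == k)%:R.
  transitivity (\sum_j (q (r j) + q (edge G (r j)))).
    by apply: eq_bigr => j _; rewrite !mxE mulrDr /q YE.
  rewrite (sum_edges _ rE) /q; have [c <-] := fS k.
  under eq_bigr do rewrite -natrM mulnb fE -in_setI.
  rewrite -natr_sum -big_mkcond /= sum1_card.
  apply/eqP; have := Yeven c.
  by rewrite -(dvdn_pcharf (pchar_Fp (isT : prime 2))) dvdn2.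
have /submxP[x yx] : (y <= A)%MS.
  have /submx_trans-> // : (y <= kermx B^T)%MS by apply/sub_kermxP.
  have /mxrank_leqif_sup[le_rk <-] : (A <= kermx B^T)%MS by apply/sub_kermxP.
  rewrite eqn_leq le_rk mxrank_ker mxrank_tr leq_subLR.
  have leS n k : (n.-1 <= k -> n <= k.+1)%N by case: n.
  (* After adding 2, Euler's formula makes the left side V + F, to be bounded by (rank A + 1) +
     (rank B + 1). *)
  rewrite -2!ltnS -addn2 -euler addnC -addnS -addSn.
  by rewrite leq_add ?leS.
exists (fun d => x 0 (v d) != 0); split=> [d|d]; first by rewrite vN.
have [j dE] := edge_index d.
have [rY rX] : (r j \in Y) = (d \in Y) /\
    x 0 (v (r j)) + x 0 (v (edge G (r j))) = x 0 (v d) + x 0 (v (edge G d)).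
  move/eqP: dE; rewrite rE eq_porbit_mem mem_porbit_edge.
  by move=> /orP[]/eqP->; split; rewrite ?YE ?edgeK // addrC.
have := mul_incidence v r x j; rewrite -yx mxE rY rX.
have F2E (a : 'F_2) : a = (a != 0)%:R by case: a => [[|[|]]] //= *; apply/val_inj.
rewrite [x 0 (v d)]F2E [x 0 (v (edge G d))]F2E.
by case: (d \in Y); case: (x 0 (v d) != 0); case: (x 0 (v (edge G d)) != 0).
Qed.

End Jordan.

(** * The dual of a 3-connected plane cubic graph is simple *)

Lemma card_seqI (T : finType) (s : seq T) (A : {set T}) :
  uniq s -> #|[set x in s] :&: A| = count (mem A) s.
Proof.
move=> sU; rewrite -size_filter -(card_uniqP (filter_uniq _ sU)).
by apply: eq_card => x; rewrite !inE mem_filter andbC.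
Qed.

Section DualSimple.
Variable G : cmap.
Hypotheses (smpG : simple_graph G) (plG : plane G).
Hypotheses (conG : k_connected G 3) (cubG : cubic G).
Implicit Types (a b c d z : dart G) (X : dart G -> bool).

Lemma edge_other_vertex d : porbit (node G) (edge G d) != porbit (node G) d.
Proof. by rewrite eq_porbit_mem; case: smpG => /(_ d). Qed.

(** Of the three darts at the tail of [a], only [a] and [b] can leave [X], so a further one leads to
    another vertex on the same side. *)
Lemma cut_other_vertex X a b :
  (forall d, X (node G d) = X d) ->
  (forall d, X d (+) X (edge G d) -> d \in [:: a; edge G a; b; edge G b]) ->
  X a -> ~~ X (edge G a) -> ~~ X (edge G b) ->
  exists2 z, X z & porbit (node G) z != porbit (node G) a.
Proof.
move=> XN cutX Xa Xea Xeb.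
have [_ /=] := porbit3 (cubG (mem_vertices a)).
rewrite !inE !negb_or !andbT => /andP[/andP[na nna] nnn].
have [z [Xz Vz za zb]] : exists z, [/\ X z, porbit (node G) z = porbit (node G) a, z != a & z != b].
  have [nb|nb] := eqVneq (node G a) b.
    exists (node G (node G a)); split; rewrite ?XN ?porbitS 1?eq_sym //.
    by rewrite -nb.
  by exists (node G a); split; rewrite ?XN ?porbitS // eq_sym.
exists (edge G z); last by rewrite -Vz edge_other_vertex.
have zY : z \notin [:: a; edge G a; b; edge G b].
  rewrite !inE !negb_or za zb /=.
  by apply/andP; split; apply: contraTneq Xz => ->.
by have := contra (cutX z) zY; rewrite Xz /= negbK.
Qed.

(** Deleting the end of [a] inside [X] and the end of [b] outside [X] destroys all crossing edges,
    and [cut_other_vertex] leaves a vertex on each side, against 3-connectedness. A bridge is the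
    case [a = b]. *)
Lemma no_two_edge_cut X a b :
  (forall d, X (node G d) = X d) ->
  (forall d, X d (+) X (edge G d) -> d \in [:: a; edge G a; b; edge G b]) ->
  X a -> ~~ X (edge G a) -> X b -> ~~ X (edge G b) -> False.
Proof.
move=> XN cutX Xa Xea Xb Xeb.
have [z Xz za] := cut_other_vertex XN cutX Xa Xea Xeb.
have [|||||z' Xz' zb] := @cut_other_vertex (fun d => ~~ X d) (edge G b) (edge G a).
- by move=> d; rewrite XN.
- move=> d; rewrite addbN addNb negbK => /cutX.
  by rewrite !edgeK !inE => /or4P[] ->; rewrite ?orbT.
- by [].
- by rewrite edgeK negbK.
- by rewrite edgeK negbK.
have XV x y : X x -> ~~ X y -> porbit (node G) x != porbit (node G) y.
  by move=> Xx; apply: contraNneq => /eqP; rewrite eq_porbit_mem => /(porbit_invariant XN)<-.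
pose S := [set porbit (node G) a; porbit (node G) (edge G b)].
have SV : S \subset vertices G by apply/subsetP=> x /set2P[]->; apply: mem_vertices.
have S2 : #|S| < 3 by rewrite cards2; case: (_ != _).
have XW d : porbit (node G) d \in vertices G :\: S ->
    porbit (node G) (edge G d) \in vertices G :\: S -> X (edge G d) = X d.
  rewrite !inE !negb_or => /andP[/andP[da db] _] /andP[/andP[eda edb] _].
  apply/eqP; rewrite eq_sym -negb_add; apply/negP => /cutX.
  by rewrite !inE => /or4P[] /eqP dE; move: da db eda edb; rewrite dE ?edgeK eqxx.
suff : X z = X z' by rewrite Xz (negPf Xz').
apply: (connected_on_const (conG.2 S SV S2) (subsetDl _ _) XN XW).
- by rewrite in_setD mem_vertices !inE negb_or za XV.
- by rewrite in_setD mem_vertices !inE negb_or zb andbT eq_sym XV.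
Qed.

(** Otherwise the edges of [c] and [d] together meet every face evenly, hence form a cut of at most
    two edges. *)
Lemma dual_simple c d :
  d \in porbit (face G) c -> edge G d \in porbit (face G) (edge G c) -> c = d.
Proof.
move=> cd ecd; apply/eqP/idPn => ncd.
(* If [d] is the reverse of [c] there is only one edge, a bridge; the list must be free of
   repetitions for the parity count. *)
pose s := if d == edge G c then [:: c; edge G c] else [:: c; edge G c; d; edge G d].
have sU : uniq s.
  have eN x : (x == edge G x) = false by rewrite eq_sym (negPf (edge_neq x)).
  rewrite /s; case: ifP => [_|/negbT dec] /=; rewrite !inE ?eN //.
  rewrite !negb_or !andbT (inj_eq perm_inj) ncd [edge G c == d]eq_sym dec andbT /=.
  by rewrite andbT; apply: contra dec => /eqP->; rewrite edgeK.
have sE z : z \in s = (z \in [:: c; edge G c; d; edge G d]).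
  rewrite /s; case: ifP => // /eqP->; rewrite edgeK !inE.
  by do 2!case: (_ == _).
pose Y := [set z in s].
have [z|z|X [XN XE]] := even_edges_cut (Y := Y) plG.
- rewrite !inE !sE !inE !(can2_eq (edgeK (c := G)) (edgeK (c := G))) !edgeK.
  by do 4!case: (_ == _).
- rewrite card_seqI // /s; move: cd ecd.
  rewrite -!eq_porbit_mem => /eqP cd /eqP ecd.
  case: ifP => [/eqP dE|_] /=; rewrite -!eq_porbit_mem.
    by rewrite -dE cd; case: (_ == _).
  by rewrite cd ecd; do 2!case: (_ == _).
have cutX z : X z (+) X (edge G z) -> z \in [:: c; edge G c; d; edge G d].
  by rewrite -XE inE sE.
have Xc : X c (+) X (edge G c) by rewrite -XE inE sE !inE eqxx.
have Xd : X d (+) X (edge G d) by rewrite -XE inE sE !inE eqxx !orbT.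
have orient x : X x (+) X (edge G x) -> exists2 a, X a && ~~ X (edge G a) &
    [:: a; edge G a] =i [:: x; edge G x].
  case Xx: (X x) => /= Xex; first by exists x; rewrite ?Xx.
  by exists (edge G x); rewrite ?edgeK ?Xx ?Xex // => y; rewrite !inE orbC.
have [a /andP[Xa Xea] aE] := orient c Xc.
have [b /andP[Xb Xeb] bE] := orient d Xd.
apply: (no_two_edge_cut XN _ Xa Xea Xb Xeb) => z /cutX.
by rewrite -[_ :: _]/([:: c; _] ++ [:: d; _])
           -[X in _ -> _ \in X]/([:: a; _] ++ [:: b; _]) !mem_cat aE bE.
Qed.

End DualSimple.

(** * Independent sets alternating along hexagons *)

Section Hexagons.
Variable G : cmap.
Hypothesis cubG : cubic G.
Hypothesis dualG : forall c d : dart G,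
  d \in porbit (face G) c -> edge G d \in porbit (face G) (edge G c) -> c = d.
Hypothesis longG : forall d, 4 < #|porbit (face G) d|.
Implicit Types (a b c d p q x y z : dart G) (A B : seq (dart G)).

Local Notation "''e' x" := (edge G x) (at level 10, x at level 9, format "''e' x").
Local Notation "''n' x" := (node G x) (at level 10, x at level 9, format "''n' x").
Local Notation "''f' x" := (face G x) (at level 10, x at level 9, format "''f' x").
Local Notation V := (porbit (node G)).
Local Notation L := (porbit (face G)).

(** * Local structure around a face; the graph here will be the original fullerene *)

Lemma node3 a : 'n ('n ('n a)) = a.
Proof. by have [] := porbit3 (cubG (mem_vertices a)). Qed.

Lemma nodeV a : (node G)^-1%g a = 'n ('n a).
Proof. by apply: (@perm_inj _ (node G)); rewrite permKV node3. Qed.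

Lemma face_edge2 a : 'f ('e a) = 'n ('n a).
Proof. by rewrite face_edge nodeV. Qed.

Lemma face_node2 a : 'f a = 'n ('n ('e a)).
Proof. by rewrite faceE nodeV. Qed.

Lemma face_surj a : exists p, a = 'f p.
Proof. by exists ((face G)^-1%g a); rewrite permKV. Qed.

Lemma mem_vertex a b : (b \in V a) = [|| b == a, b == 'n a | b == 'n ('n a)].
Proof. by rewrite porbit_traject (cubG (mem_vertices a)) !inE. Qed.

Lemma vertexE a b : V a = V b -> [\/ b = a, b = 'n a | b = 'n ('n a)].
Proof.
move/eqP; rewrite eq_sym eq_porbit_mem mem_vertex.
by case/or3P=> /eqP->; [exact: Or31 | exact: Or32 | exact: Or33].
Qed.

(** The dart ['n ('n a)] is the third one at the tail of [a] and points away from the face of [a].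
    On its left is the face across [a]; on its right, by the next lemma, the face across the
    boundary edge preceding [a]. *)
Lemma outer_face a : L ('n ('n a)) = L ('e a).
Proof. by rewrite -face_edge2 porbitS. Qed.

Lemma edge_outer_face a : L ('e ('n ('n ('f a)))) = L ('e a).
Proof. by rewrite -porbitS face_edge2 !node3 node_face. Qed.

Lemma nbr_inj a b : L a = L b -> L ('e a) = L ('e b) -> a = b.
Proof. by move=> ab eab; apply: dualG; rewrite -eq_porbit_mem ?ab ?eab. Qed.

Lemma nbr_neq a : L ('e a) <> L a.
Proof.
move=> h; have := nbr_inj (esym h); rewrite edgeK h => /(_ erefl)/eqP.
by rewrite eq_sym (negPf (edge_neq a)).
Qed.

Lemma face_vertex_inj a b : L a = L b -> V a = V b -> a = b.
Proof.
move=> ab /vertexE[->|bE|bE] //; case: (@nbr_neq b).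
  by rewrite -ab -porbitS face_edge2 bE node3.
by move: ab; rewrite bE outer_face => /esym/nbr_neq.
Qed.

Lemma face_iter_neq k a : 0 < k < 5 -> iter k (face G) a <> a.
Proof.
move=> /andP[k0 k5] ak; have ka := leq_trans k5 (longG a).
have := uniq_traject_porbit (face G) a => /uniqP -/(_ a k 0).
rewrite !inE !size_traject !nth_traject ?(leq_trans _ ka) //= => /(_ isT isT ak) k_eq0.
by rewrite k_eq0 in k0.
Qed.

(* The edges leaving the faces of [a] and [b] at these darts coincide. *)
Definition linked a b := 'e ('n ('n a)) == 'n ('n b).

Lemma linkedC a b : linked a b = linked b a.
Proof. by rewrite /linked (can2_eq (edgeK (c := G)) (edgeK (c := G))) eq_sym. Qed.

(** Both sides are the face on one side of the linking edge: it runs along the boundary edge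
    entering one end and along the one leaving the other. *)
Lemma linked_nbr p q : linked ('f p) ('f q) -> L ('e ('f q)) = L ('e p).
Proof. by move/eqP=> pq; rewrite -outer_face -pq edge_outer_face. Qed.

Lemma linked_face a b : linked a b -> 'f ('n ('n a)) = 'n b.
Proof. by rewrite face_node2 => /eqP->; rewrite node3. Qed.

Lemma linked_inj a b b' : linked a b -> linked a b' -> b = b'.
Proof. by rewrite /linked => /eqP-> /eqP/perm_inj/perm_inj. Qed.

(** The inequalities rule out that [c] is a boundary edge of either face, which leaves the outward
    edge at both ends. *)
Lemma linkedP p q c :
  c \in V ('f p) -> 'e c \in V ('f q) ->
  V p != V ('f q) -> V ('f ('f p)) != V ('f q) ->
  V ('f p) != V q -> V ('f p) != V ('f ('f q)) -> linked ('f p) ('f q).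
Proof.
have aux d r s : d \in V ('f r) -> 'e d \in V s -> V r != V s ->
    V ('f ('f r)) != V s -> d = 'n ('n ('f r)).
  rewrite mem_vertex => /or3P[]/eqP-> //; rewrite -eq_porbit_mem => /eqP<-.
    by rewrite -(node_face ('f r)) porbitS eqxx.
  by rewrite node_face edgeK eqxx.
move=> cp ecq pq fpq qp fqp; apply/eqP; rewrite -(aux _ _ _ cp ecq pq fpq).
by apply: (aux _ _ ('f p) ecq); rewrite ?edgeK // eq_sym.
Qed.

(** Faces have no chords: the face beside a chord would border the given face along two edges. *)
Lemma adjacent_on_face p q c :
  c \in V ('f p) -> 'e c \in V ('f q) -> L p = L q ->
  'f q = 'f ('f p) \/ 'f p = 'f ('f q).
Proof.
move=> cp ecq pq.
have [/face_vertex_inj h|h1] := eqVneq (V p) (V ('f q)).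
  by right; rewrite -h // porbitS.
have [/face_vertex_inj h|h2] := eqVneq (V ('f ('f p))) (V ('f q)).
  by left; rewrite h // !porbitS.
have [/face_vertex_inj h|h3] := eqVneq (V ('f p)) (V q).
  by left; rewrite h // porbitS.
have [/face_vertex_inj h|h4] := eqVneq (V ('f p)) (V ('f ('f q))).
  by right; rewrite h // !porbitS.
have /linked_nbr h := linkedP cp ecq h1 h2 h3 h4.
by right; rewrite (nbr_inj _ h) // porbitS.
Qed.

(** Both links lie on the face across ['f p]. It shares a single edge with the face of [q], so the
    ends of the links are consecutive there too, and the face between the links has length four. *)
Lemma no_quadrilateral p q q' :
  L q = L q' -> linked ('f p) ('f q) -> linked ('f ('f p)) ('f q') -> False.
Proof.
move=> qq' pq pq'.
have q'E : q = 'f q'.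
  apply: nbr_inj; rewrite ?porbitS // (linked_nbr pq').
  by move: pq; rewrite linkedC => /linked_nbr->.
rewrite -q'E linkedC in pq'.
apply: (@face_iter_neq 4 ('e ('f p))) => //=.
by rewrite face_edge2 (linked_face pq) node_face face_edge2 (linked_face pq') node_face.
Qed.

(** The second hypothesis makes the outward edges at [a] and [a'] meet in a vertex. The face between
    them forces [a'] to follow [a] on the boundary, and so has length three. *)
Lemma no_triangle a a' :
  L a = L a' -> 'e ('n ('n a')) = 'n ('n ('e ('n ('n a)))) -> False.
Proof.
have [p ->] := face_surj a'; rewrite porbitS => ap h.
have {}ap : a = p.
  apply: nbr_inj => //.
  by rewrite -[RHS]edge_outer_face h outer_face edgeK outer_face.
apply: (@face_iter_neq 3 ('e a)) => //=.
by rewrite face_edge2 (face_node2 ('n ('n a))) -h face_node2 edgeK node3 node_face ap.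
Qed.

(** * The two classes of alternate vertices of a hexagon *)

Definition alternate x := [:: x; 'f ('f x); 'f ('f ('f ('f x)))].

Definition near A : pred (dart G) := fun z => has (fun a => z \in V a) A.

Lemma near_node A z : near A ('n z) = near A z.
Proof. by apply: eq_has => a; rewrite -!eq_porbit_mem porbitS. Qed.

Definition hex x := #|L x| = 6.

Lemma hex6 x : hex x -> 'f ('f ('f ('f ('f ('f x))))) = x.
Proof. by move=> hx; have := iter_porbit (face G) x; rewrite hx. Qed.

Lemma hex_face x : hex x -> hex ('f x).
Proof. by rewrite /hex porbitS. Qed.

Lemma mem_hex x a : hex x -> (a \in L x) = (a \in alternate x) || (a \in alternate ('f x)).
Proof. by move=> hx; rewrite porbit_traject hx !inE; do 6!case: (a == _). Qed.

Lemma alternate_orbit x a : a \in alternate x -> L a = L x.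
Proof. by rewrite !inE => /or3P[]/eqP->; rewrite ?porbitS. Qed.

Lemma hex_uniq x : hex x -> uniq (alternate x ++ alternate ('f x)).
Proof.
move=> hx; have := uniq_traject_porbit (face G) x; rewrite hx.
have /perm_uniq-> // : perm_eq (alternate x ++ alternate ('f x)) (traject (face G) x 6).
by apply/seq.permP=> P /=; do 6!case: (P _).
Qed.

Lemma alternate_face x a : a \in alternate x -> 'f a \in alternate ('f x).
Proof. by rewrite !inE => /or3P[]/eqP->; rewrite eqxx ?orbT. Qed.

Lemma alternate_predE x p : hex x -> (p \in alternate ('f x)) = ('f p \in alternate x).
Proof.
move=> hx; have xE : ('f p == x) = (p == 'f ('f ('f ('f ('f x))))).
  by rewrite -{1}(hex6 hx) (inj_eq perm_inj).
by rewrite !inE xE !(inj_eq perm_inj); do 3!case: (p == _).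
Qed.

Lemma alternate_disjoint x a :
  hex x -> a \in alternate x -> a \notin alternate ('f x).
Proof.
by move=> /hex_uniq; rewrite cat_uniq => /and3P[_ + _] ax; apply: contra => ?; apply/hasP; exists a.
Qed.

Lemma alternate_face2 x : hex x -> alternate ('f ('f x)) =i alternate x.
Proof.
by move=> hx a; rewrite !inE hex6 //; do 3!case: (a == _).
Qed.

Definition independent (s : pred (dart G)) := forall d, ~~ (s d && s ('e d)).

(** Serves both for a set of vertices along a face of the fullerene and for a matching along a face
    of its leapfrog. *)
Definition alternates (s : pred (dart G)) x := forall c, c \in L x -> s c != s ('f c).

(** The list [A] leaves room for a second hexagon, whose chosen vertices may lie on this one only in
    the class of [x]. *)
Lemma near_alternates x A : hex x ->
  (forall z a, z \in alternate ('f x) -> a \in A -> V z != V a) ->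
  alternates (near (alternate x ++ A)) x.
Proof.
move=> hx xA.
have even c : c \in alternate x -> near (alternate x ++ A) c.
  by move=> cx; apply/hasP; exists c; rewrite ?mem_cat ?cx ?porbit_id.
have odd c : c \in alternate ('f x) -> ~~ near (alternate x ++ A) c.
  move=> cx; apply/hasPn => a; rewrite mem_cat -eq_porbit_mem => /orP[ax|]; last exact: xA.
  apply/eqP => /face_vertex_inj ca.
  move: (alternate_disjoint hx ax); rewrite -ca ?cx //.
  by rewrite ca // (alternate_orbit ax) (alternate_orbit cx) porbitS.
move=> c; rewrite mem_hex // => /orP[cx|cx].
  by rewrite even // (negPf (odd _ (alternate_face cx))).
by rewrite (even ('f c)) -?alternate_predE // (negPf (odd _ cx)).
Qed.

Lemma near_independent A :
  {in A &, forall a b c, c \in V a -> 'e c \notin V b} -> independent (near A).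
Proof.
move=> indA d; apply/negP => /andP[/hasP[a aA da] /hasP[b bA]].
exact/negP/(indA a b).
Qed.

Lemma alternate_independent x : hex x ->
  {in alternate x &, forall a b c, c \in V a -> 'e c \notin V b}.
Proof.
move=> hx a b ax bx c ca; apply/negP => cb.
have [p pa] := face_surj a; have [q qb] := face_surj b.
have pq : L p = L q
  by rewrite -porbitS -pa -[RHS]porbitS -qb (alternate_orbit ax) (alternate_orbit bx).
rewrite pa in ca; rewrite qb in cb.
have [] := adjacent_on_face ca cb pq; rewrite -pa -qb => ab.
  by move: (alternate_disjoint hx bx); rewrite ab alternate_face.
by move: (alternate_disjoint hx ax); rewrite ab alternate_face.
Qed.

(** The union of the two classes works. Inside a class an edge would be a chord; between them it
    would be either a boundary edge, excluded because the classes agree on common vertices, or a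
    link. *)
Lemma linked_classes x y : hex x -> hex y ->
  (forall z b, z \in alternate ('f x) -> b \in alternate y -> V z != V b) ->
  (forall z a, z \in alternate ('f y) -> a \in alternate x -> V z != V a) ->
  (forall a b, a \in alternate x -> b \in alternate y -> ~~ linked a b) ->
  exists s : pred (dart G), [/\ forall d, s ('n d) = s d, independent s,
    alternates s x & alternates s y].
Proof.
move=> hx hy xy yx unlinked.
have cross a b c : a \in alternate x -> b \in alternate y -> c \in V a -> 'e c \notin V b.
  move=> ax bY ca; apply/negP => cb.
  have [p pa] := face_surj a; have [q qb] := face_surj b.
  have px : p \in alternate ('f x) by rewrite (alternate_predE _ hx) -?pa.
  have qy : q \in alternate ('f y) by rewrite (alternate_predE _ hy) -?qb.
  move: (unlinked a b ax bY) => /negP[]; rewrite pa qb in ca cb *.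
  apply: linkedP ca cb _ _ _ _; rewrite -?pa -?qb.
  - exact: xy.
  - exact/xy/bY/alternate_face.
  - by rewrite eq_sym yx.
  - by rewrite eq_sym yx // alternate_face.
exists (near (alternate x ++ alternate y)); split.
- exact: near_node.
- apply: near_independent => a b; rewrite !mem_cat => /orP[ax|aY] /orP[bx|bY] c ca.
  + exact: (alternate_independent hx ax bx ca).
  + exact: cross ca.
  + apply/negP => cb; have := cross b a ('e c) bx aY cb.
    by rewrite edgeK ca.
  + exact: (alternate_independent hy aY bY ca).
- exact: near_alternates.
- move=> c cy; have := near_alternates hy yx cy.
  by rewrite /near !has_cat orbC [X in _ != X]orbC.
Qed.

(** * Two hexagons without common vertices *)

Lemma consecutive_alternate x a c d : hex x ->
  a \in alternate x -> c \in alternate ('f x) -> d \in alternate ('f x) -> c != d ->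
  [\/ c = 'f a, d = 'f a, a = 'f c | a = 'f d].
Proof.
move=> hx; rewrite !inE => /or3P[]/eqP-> /or3P[]/eqP-> /or3P[]/eqP->;
  rewrite ?eqxx ?hex6 // => _; by [apply: Or41 | apply: Or42 | apply: Or43 | apply: Or44].
Qed.

Lemma linked_consecutive a b b' : L b = L b' -> linked a b -> linked ('f a) b' -> False.
Proof.
have [[p ->] [q ->]] := (face_surj a, face_surj b); have [q' ->] := face_surj b'.
by rewrite !porbitS; apply: no_quadrilateral.
Qed.

(** Three pairings of a class of [x] with a class of [y] are tried in turn; they cannot all be
    linked. *)
Lemma disjoint_hexagons x y : hex x -> hex y ->
  (forall a b, a \in L x -> b \in L y -> V a != V b) ->
  exists s : pred (dart G), [/\ forall d, s ('n d) = s d, independent s,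
    alternates s x & alternates s y].
Proof.
move=> hx hy xy.
pose bad x' y' := has (fun a => has (linked a) (alternate y')) (alternate x').
have good x' y' : L x' = L x -> L y' = L y -> ~~ bad x' y' ->
    exists s : pred (dart G), [/\ forall d, s ('n d) = s d, independent s,
      alternates s x & alternates s y].
  move=> xE yE nbad; rewrite /alternates -xE -yE.
  apply: linked_classes; rewrite /hex ?xE ?yE //.
  - move=> z b /alternate_orbit + /alternate_orbit; rewrite porbitS => zx bY.
    by apply: xy; rewrite -eq_porbit_mem ?zx ?bY ?xE ?yE.
  - move=> z b /alternate_orbit + /alternate_orbit; rewrite porbitS => zx bY.
    by rewrite eq_sym; apply: xy; rewrite -eq_porbit_mem ?zx ?bY ?xE ?yE.
  - by move=> a b ax bY; have /hasPn/(_ a ax)/hasPn/(_ b bY) := nbad.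
have [/hasP[a ax /hasP[b bY ab]]|] := boolP (bad x y); last exact: good.
have [/hasP[c cx /hasP[b' bY' cb']]|] := boolP (bad ('f x) y);
  last by apply: good; rewrite ?porbitS.
have [/hasP[d dx /hasP[b'' bY'' db'']]|] := boolP (bad ('f x) ('f y));
  last by apply: good; rewrite ?porbitS.
(* A vertex carries at most one link, while [b'] and [b''] lie in different classes. *)
have cd : c != d.
  apply/eqP => cd; move: cb'; rewrite cd => /(linked_inj db'')/esym.
  by move=> bE; move: (alternate_disjoint hy bY'); rewrite bE bY''.
have {bY} bY := alternate_orbit bY; have {bY'} bY' := alternate_orbit bY'.
have {bY''} bY'' := alternate_orbit bY''; rewrite porbitS in bY''.
(* A vertex of a hexagon is adjacent to two of the three vertices of the other class, so [a] is next
   to [c] or [d]; the two links there bound a quadrilateral. *)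
exfalso; have [] := consecutive_alternate hx ax cx dx cd => E;
  [move: cb'|move: db''|move: ab|move: ab]; rewrite E => h.
- by apply: linked_consecutive ab h; rewrite bY bY'.
- by apply: linked_consecutive ab h; rewrite bY bY''.
- by apply: linked_consecutive cb' h; rewrite bY bY'.
- by apply: linked_consecutive db'' h; rewrite bY bY''.
Qed.

(** * Two hexagons sharing an edge *)

Lemma shared_vertex x a b : a \in L x -> b \in L ('e x) -> V a = V b ->
  (a = x /\ b = 'f ('e x)) \/ (a = 'f x /\ b = 'e x).
Proof.
rewrite -!eq_porbit_mem => /eqP ax /eqP bx /vertexE[ab|ab|ab].
- by case: (@nbr_neq x); rewrite -bx ab ax.
- right; have [p pa] := face_surj a; rewrite pa node_face in ab.
  have px : p = x by apply: nbr_inj; rewrite -?ab // -ax pa porbitS.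
  by rewrite pa ab px.
- left; rewrite ab outer_face in bx.
  by rewrite -(nbr_inj ax bx) ab face_edge2.
Qed.

Lemma shared_edge_outer x : hex ('e x) ->
  'n ('n ('f x)) = 'e ('f ('f ('f ('f ('f ('e x)))))).
Proof. by move=> hy; rewrite -node_face hex6 // face_node2 node3. Qed.

(** Number the boundaries x_i and y_i from [x] and ['e x], so that x_0 = y_1 and x_1 = y_0 as
    vertices. A link at the shared vertex makes a face border itself, x_2 y_5 closes a triangle at
    x_1, and x_2 y_3 or x_4 y_5 makes two faces share two edges. Only x_4 y_3 remains. *)
Lemma shared_edge_linked x a b : hex x -> hex ('e x) ->
  a \in alternate x -> b \in alternate ('f ('e x)) -> linked a b ->
  a = 'f ('f ('f ('f x))) /\ b = 'f ('f ('f ('e x))).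
Proof.
move=> hx hy ax bY ab.
have xyE : L ('e ('f x)) = L ('e ('f ('f ('f ('f ('f ('e x))))))).
  by rewrite -outer_face shared_edge_outer.
have [p pa] := face_surj a; have [q qb] := face_surj b.
have pq : L ('e b) = L ('e p) by rewrite qb; apply: linked_nbr; rewrite -pa -qb.
have qp : L ('e a) = L ('e q) by rewrite pa; apply: linked_nbr; rewrite -pa -qb linkedC.
have qx : L q = L ('e x) by rewrite -porbitS -qb (alternate_orbit bY) porbitS.
have px : L p = L x by rewrite -porbitS -pa (alternate_orbit ax).
have aL := alternate_orbit ax; have bL := alternate_orbit bY.
rewrite porbitS in bL.
move: ax bY; rewrite !inE => /or3P[]/eqP aE.
- by case: (@nbr_neq q); rewrite qx -qp aE.
- have {}px : p = 'f x by apply/(@perm_inj _ (face G)); rewrite -pa.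
  rewrite px xyE in pq; case/or3P=> /eqP bE.
  + by case: (@nbr_neq a); rewrite qp aL (_ : q = 'e x) ?edgeK //;
       apply/(@perm_inj _ (face G)); rewrite -qb.
  + by case: (@face_iter_neq 2 b) => //=; rewrite [in LHS]bE;
       apply/esym/nbr_inj; rewrite // !porbitS.
  + case: (@face_iter_neq 3 ('e ('f x))) => //=.
    rewrite face_edge2 shared_edge_outer // -bE face_edge2.
    by rewrite linkedC in ab; rewrite (linked_face ab) aE node_face.
- have {}px : p = 'f ('f ('f x)) by apply/(@perm_inj _ (face G)); rewrite -pa.
  rewrite px in pq; case/or3P=> /eqP bE //.
  + by case: (@nbr_neq a); rewrite qp aL (_ : q = 'e x) ?edgeK //;
       apply/(@perm_inj _ (face G)); rewrite -qb.
  + case: (@face_iter_neq 2 ('f x)) => //=; apply: nbr_inj; first by rewrite !porbitS.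
    by rewrite -pq xyE bE.
Qed.

(** Agreement on the shared edge leaves two choices of classes. In the numbering of
    [shared_edge_linked], their only possible links are x_4 y_3 and, by symmetry, x_3 y_4; both
    together bound a quadrilateral. *)
Lemma adjacent_hexagons x : hex x -> hex ('e x) ->
  exists s : pred (dart G), [/\ forall d, s ('n d) = s d, independent s,
    alternates s x & alternates s ('e x)].
Proof.
move=> hx hy.
have sub z a : a \in alternate z -> a \in L z.
  by move=> /alternate_orbit/eqP; rewrite eq_porbit_mem.
have subf z a : a \in alternate ('f z) -> a \in L z by move=> /sub; rewrite porbitS.
have odd z a : hex z -> a \in alternate ('f z) -> a \notin alternate z.
  by move=> hz /(alternate_disjoint (hex_face hz)); rewrite alternate_face2.
have unshared a b : V a = V b -> a \in L x -> b \in L ('e x) ->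
    (a \in alternate x) = (b \in alternate ('f ('e x))).
  move=> ab ax bx; have [] := shared_vertex ax bx ab => -[-> ->].
    by rewrite !mem_head.
  by rewrite -(alternate_predE _ hx) !(negPf (alternate_disjoint _ (mem_head _ _))).
have [/hasP[a ax /hasP[b bY ab]]|/hasPn nbad] :=
  boolP (has (fun a => has (linked a) (alternate ('f ('e x)))) (alternate x)).
  have [/hasP[a' ax' /hasP[b' bY' ab']]|/hasPn nbad] :=
    boolP (has (fun a => has (linked a) (alternate ('e x))) (alternate ('f x))).
    exfalso; have [aE bE] := shared_edge_linked hx hy ax bY ab.
    rewrite linkedC in ab'; rewrite -{1}[x]edgeK in ax'.
    have [] := shared_edge_linked hy _ bY' ax' ab'; rewrite edgeK // => bE' aE'.
    rewrite bE' aE' linkedC in ab'; rewrite aE bE in ab.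
    by apply: linked_consecutive ab' ab; rewrite !porbitS.
  rewrite /alternates -[L x](porbitS (face G)).
  apply: linked_classes => //; first exact: hex_face.
  - move=> z c; rewrite alternate_face2 // => zx cY; apply/eqP => /unshared.
    by rewrite !sub // zx (negPf (alternate_disjoint hy cY)) => /(_ isT isT).
  - move=> z c zY cx; apply/eqP => /esym/unshared.
    by rewrite !subf // zY (negPf (odd _ _ hx cx)) => /(_ isT isT).
  - by move=> a' b' ax' bY'; have /hasPn/(_ b' bY') := nbad a' ax'.
rewrite /alternates -[L ('e x)](porbitS (face G)).
apply: linked_classes => //; first exact: hex_face.
- move=> z b zx bY; apply/eqP => /unshared.
  by rewrite !subf // bY (negPf (odd _ _ hx zx)) => /(_ isT isT).
- move=> z a; rewrite alternate_face2 // => zY ax; apply/eqP => /esym/unshared.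
  by rewrite !sub // ax (negPf (alternate_disjoint hy zY)) => /(_ isT isT).
- by move=> a b ax bY; have /hasPn/(_ b bY) := nbad a ax.
Qed.

Lemma two_hexagons x y : hex x -> hex y ->
  exists s : pred (dart G), [/\ forall d, s ('n d) = s d, independent s,
    alternates s x & alternates s y].
Proof.
move=> hx hy; have [xy|xy] := eqVneq (L x) (L y).
  rewrite /alternates -xy; exists (near (alternate x ++ [::])); split.
  - exact: near_node.
  - by apply: near_independent; rewrite cats0; apply: alternate_independent.
  - exact: near_alternates.
  - exact: near_alternates.
have [/existsP[a /andP[ax /existsP[b /andP[bY /eqP ab]]]]|apart] :=
    boolP [exists a in L x, exists b in L y, V a == V b].
  (* At a vertex of degree three, two distinct faces meeting there share an edge. *)
  have [x' x'x y'y] : exists2 x', L x' = L x & L ('e x') = L y.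
    move: ax bY; rewrite -!eq_porbit_mem => /eqP ax /eqP bY.
    have [bE|bE|bE] := vertexE ab.
    - by case/eqP: xy; rewrite -ax -bE bY.
    - have [p pa] := face_surj a; exists p; first by rewrite -ax pa porbitS.
      by rewrite -bY bE pa node_face.
    - by exists a; rewrite // -bY bE outer_face.
  by rewrite /alternates -x'x -y'y; apply: adjacent_hexagons; rewrite /hex ?x'x ?y'y.
apply: disjoint_hexagons => // a b ax bY; apply: contra apart => ab.
by apply/existsP; exists a; rewrite ax; apply/existsP; exists b; rewrite bY.
Qed.

(** * A hexagon and a vertex off it *)

Lemma spoke_outer x v a c : L a = L x -> (forall b, b \in L x -> V b != V v) ->
  c \in V v -> 'e c \in V a -> 'e c = 'n ('n a).
Proof.
move=> ax off; rewrite -eq_porbit_mem => /eqP cv; rewrite mem_vertex => /or3P[]/eqP // ec.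
  have /eqP[] : V ('f a) != V v by apply: off; rewrite -eq_porbit_mem porbitS ax.
  by rewrite -cv -porbitS node_face -ec edgeK.
have [p pa] := face_surj a; have /eqP[] : V p != V v.
  by apply: off; rewrite -eq_porbit_mem -porbitS -pa ax.
by rewrite -cv -[c]edgeK ec pa node_face edgeK.
Qed.

(** If both classes contained a neighbour of [v], the outward edges at two distinct vertices of the
    hexagon would meet in [v], giving a triangle. *)
Lemma hexagon_off_vertex x v : hex x -> (forall a, a \in L x -> V a != V v) ->
  exists s : pred (dart G), [/\ forall d, s ('n d) = s d, independent s,
    alternates s x & forall c, c \in V v -> ~~ s c && ~~ s ('e c)].
Proof.
move=> hx off.
pose bad x' := has (fun c => near (alternate x') ('e c)) (enum (V v)).
have good x' : L x' = L x -> ~~ bad x' ->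
    exists s : pred (dart G), [/\ forall d, s ('n d) = s d, independent s,
      alternates s x & forall c, c \in V v -> ~~ s c && ~~ s ('e c)].
  move=> xE nbad; have hx' : hex x' by rewrite /hex xE.
  rewrite /alternates -xE; exists (near (alternate x' ++ [::])); split.
  - exact: near_node.
  - by apply: near_independent; rewrite cats0; apply: alternate_independent.
  - exact: near_alternates.
  - move=> c cv; rewrite cats0 (hasPn nbad) ?mem_enum // andbT.
    apply/hasPn => a /alternate_orbit ax.
    have := off a; rewrite -eq_porbit_mem ax xE eqxx => /(_ isT).
    by move: cv; rewrite -!eq_porbit_mem => /eqP->; rewrite eq_sym.
have [/hasP[c + /hasP[a ax ca]]|] := boolP (bad x); last exact: good.
have [/hasP[d + /hasP[b bx db]]|] := boolP (bad ('f x)); last first.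
  by move=> nbad _; apply: good nbad; rewrite porbitS.
rewrite !mem_enum => dv cv; exfalso.
have aL := alternate_orbit ax; have bL := alternate_orbit bx; rewrite porbitS in bL.
have cE := spoke_outer aL off cv ca; have dE := spoke_outer bL off dv db.
have : V c = V d by move: cv dv; rewrite -!eq_porbit_mem => /eqP-> /eqP->.
(* The darts [c] and [d] at [v] coincide, or one follows the other in the rotation at [v], in one
   order or the other. *)
move/vertexE; rewrite -[c]edgeK -[d]edgeK cE dE => -[h|h|h].
- move: h => /perm_inj/perm_inj/perm_inj ba.
  by move: (alternate_disjoint hx ax); rewrite -ba bx.
- by apply: (@no_triangle b a); rewrite ?aL ?bL // h node3.
- by apply: (@no_triangle a b); rewrite ?aL ?bL.
Qed.

End Hexagons.

(** * Perfect matchings of leapfrog graphs *)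

Section Matchings.
Variables (G : cmap) (m : pred (dart G)).
Hypothesis m_edge : forall x, m (edge G x) = m x.
Hypothesis m_ex : forall x, exists2 y, y \in porbit (node G) x & m y.
Hypothesis m_uniq : forall x y, y \in porbit (node G) x -> m x -> m y -> x = y.

Definition matching_of : {set {set dart G}} := [set porbit (edge G) x | x in m].

Lemma mem_matching_of x : (porbit (edge G) x \in matching_of) = m x.
Proof.
apply/imsetP/idP => [[y my /eqP]|mx]; last by exists x.
by rewrite eq_porbit_mem => /(porbit_invariant m_edge)->.
Qed.

Lemma matching_of_perfect : perfect_matching matching_of.
Proof.
split=> [|v /imsetP[x _ ->]]; first by apply/subsetP=> _ /imsetP[x _ ->]; apply: imset_f.
have [y yx my] := m_ex x; apply/eqP/cards1P; exists (porbit (edge G) y).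
apply/setP=> E; rewrite !inE; apply/andP/eqP => [[/imsetP[z mz ->]]|->].
  case/pred0Pn => t /andP[/= tz tx].
  have mt : m t by rewrite (porbit_invariant m_edge tz).
  rewrite (m_uniq _ my mt) //; last first.
    by move: yx tx; rewrite -!eq_porbit_mem => /eqP->.
  by apply/eqP; rewrite eq_sym eq_porbit_mem.
rewrite mem_matching_of; split=> //; apply/pred0Pn.
by exists y; rewrite /= porbit_id.
Qed.

End Matchings.

Section Leapfrog.
Variable F : cmap.
Implicit Types (d v : dart F) (s : pred (dart F)).
Local Notation G := (leapfrog F).
Local Notation Old := (@Old F : dart F -> dart G).
Local Notation Spoke := (@Spoke F : dart F -> dart G).
Local Notation Centre := (@Centre F : dart F -> dart G).

Lemma stellation_nodeE (x : stell_dart F) : node (stellation F) x = stell_node_fun x.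
Proof. exact: permE. Qed.

Lemma stellation_edgeE (x : stell_dart F) : edge (stellation F) x = stell_edge_fun x.
Proof. exact: permE. Qed.

Lemma leapfrog_edgeE (x : dart G) : edge G x = stell_edge_fun x.
Proof. exact: permE. Qed.

Lemma node_leapfrogE x y :
  node (stellation F) y = edge (stellation F) x -> node G x = y.
Proof. by move=> yx; apply: etrans (@faceE (stellation F) x) _; rewrite -yx permK. Qed.

(** A vertex of the leapfrog graph is a triangle of the stellation, and these correspond to the
    darts [d] of [F]: the darts based there are [Old d], [Spoke (face F d)] and [Centre d]. *)
Lemma node_Old d : node G (Old d) = Spoke (face F d).
Proof. by apply: node_leapfrogE; rewrite stellation_nodeE stellation_edgeE /= node_face. Qed.

Lemma node_Spoke d : node G (Spoke (face F d)) = Centre d.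
Proof. by apply: node_leapfrogE; rewrite stellation_nodeE stellation_edgeE. Qed.

Lemma node_Centre d : node G (Centre d) = Old d.
Proof. by apply: node_leapfrogE; rewrite stellation_nodeE stellation_edgeE. Qed.

Lemma face_leapfrogE (x y : dart G) : node G y = edge G x -> face G x = y.
Proof. by move=> yx; rewrite faceE -yx permK. Qed.

Lemma face_Old d : face G (Old d) = Centre (edge F d).
Proof. by apply: face_leapfrogE; rewrite node_Centre leapfrog_edgeE. Qed.

Lemma face_Spoke d : face G (Spoke d) = Spoke (face F d).
Proof. by apply: face_leapfrogE; rewrite node_Spoke leapfrog_edgeE. Qed.

Lemma face_Centre d : face G (Centre d) = Old (edge F (node F d)).
Proof. by apply: face_leapfrogE; rewrite node_Old face_edge permK leapfrog_edgeE. Qed.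

(* The matching dual to the edges of [F], switched along the hexagons around
   the vertices in [s]; [Old d] and its reverse lie in it unless an end of the
   edge [d] of [F] is in [s]. *)
Definition switched s : pred (dart G) := fun x =>
  match x with
  | Defs.Old d => ~~ s d && ~~ s (edge F d)
  | Defs.Spoke d | Defs.Centre d => s d
  end.

Section Switched.
Variable s : pred (dart F).
Hypotheses (s_node : forall d, s (node F d) = s d) (s_ind : independent s).

Lemma switched_edge x : switched s (edge G x) = switched s x.
Proof. by rewrite leapfrog_edgeE; case: x => d //=; rewrite edgeK andbC. Qed.

Lemma s_face d : s (face F d) = s (edge F d).
Proof. by rewrite -node_face s_node. Qed.

(** At the vertex belonging to [d], the darts [Centre d], [Spoke (face F d)] and [Old d] are
    selected when [s] contains the tail of [d], its head, or neither. Independence makes these cases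
    exclusive, which gives uniqueness below. *)
Lemma switched_ex x : exists2 y, y \in porbit (node G) x & switched s y.
Proof.
have [d ->] : exists d, porbit (node G) x = porbit (node G) (Old d).
  case: x => d; first by exists d.
    by have [p ->] := face_surj d; exists p; rewrite -node_Old porbitS.
  by exists d; rewrite -node_Centre porbitS.
have [sd|nsd] := boolP (s d).
  by exists (Centre d); rewrite // -eq_porbit_mem -node_Centre porbitS.
have [sed|nsed] := boolP (s (edge F d)).
  by exists (Spoke (face F d)); rewrite /= ?s_face // -node_Old -eq_porbit_mem porbitS.
by exists (Old d); rewrite ?porbit_id //= nsd.
Qed.

Lemma switched_uniq x y :
  y \in porbit (node G) x -> switched s x -> switched s y -> x = y.
Proof.
pose base (z : dart G) := match z with
  | Defs.Old d | Defs.Centre d => d | Defs.Spoke d => (face F)^-1%g d end.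
have base_node z : base (node G z) = base z.
  case: z => d; first by rewrite node_Old /= permK.
    by have [p ->] := face_surj d; rewrite node_Spoke /= permK.
  by rewrite node_Centre.
have baseE z : [\/ z = Old (base z), z = Spoke (face F (base z)) | z = Centre (base z)].
  by case: z => d; [apply: Or31 | apply: Or32; rewrite /= permKV | apply: Or33].
move=> /(porbit_invariant base_node) yx.
have [xE|xE|xE] := baseE x; have [yE|yE|yE] := baseE y; rewrite xE yE yx //= ?s_face;
  by move: (s_ind (base x)); case: (s _) (s _) => [] [].
Qed.

End Switched.

(** * The faces of the leapfrog graph around faces and around vertices of [F] *)

Lemma face_orbit_Spoke d : porbit (face G) (Spoke d) = Spoke @: porbit (face F) d.
Proof. by apply: porbit_conj => z; rewrite face_Spoke. Qed.

Lemma hex_Spoke d : hex (Spoke d) -> hex d.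
Proof. by rewrite /hex face_orbit_Spoke card_imset // => x y []. Qed.

Lemma switched_Spoke s d : alternates s d -> alternates (switched s) (Spoke d).
Proof.
by move=> sd c; rewrite face_orbit_Spoke => /imsetP[z zd ->]; rewrite face_Spoke; apply: sd.
Qed.

Lemma switched_Centre s v :
  (forall c, c \in porbit (node F) v -> ~~ s c && ~~ s (edge F c)) ->
  alternates (switched s) (Centre v).
Proof.
move=> sv c.
(* The darts of the hexagon around [v] are [Centre d] for [d] leaving [v] and [Old d] for [d]
   entering [v]; of these, [switched s] contains exactly the latter. *)
pose g (z : dart G) := match z with
  | Defs.Old d => edge F d \in porbit (node F) v
  | Defs.Centre d => d \in porbit (node F) v
  | Defs.Spoke _ => false end.
have gF z : g (face G z) = g z.
  case: z => d; first by rewrite face_Old.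
    by rewrite face_Spoke.
  by rewrite face_Centre /= edgeK -!eq_porbit_mem porbitS.
move=> /(porbit_invariant gF); rewrite /= porbit_id; case: c => //= d dv.
  by have /andP[] := sv _ dv; rewrite face_Old edgeK /= => /negPf-> /negPf->.
rewrite face_Centre /= edgeK; have /andP[/negPf-> _] := sv _ dv.
by have /andP[/negPf-> /negPf->] : ~~ s (node F d) && ~~ s (edge F (node F d))
  by apply: sv; rewrite -eq_porbit_mem porbitS eq_porbit_mem.
Qed.

Lemma dart_kind (x : dart G) :
  (exists d, porbit (face G) x = porbit (face G) (Spoke d)) \/
  (exists v, porbit (face G) x = porbit (face G) (Centre v)).
Proof.
case: x => d; [right|left|right]; try by exists d.
by exists (edge F d); rewrite -face_Old porbitS.
Qed.

(** [Spoke (face F a)] and [Centre a] start at the same leapfrog vertex, so the hexagons around a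
    face and around a vertex of that face meet. *)
Lemma Spoke_Centre_vertex d v :
  (forall a b, a \in porbit (face G) (Spoke d) -> b \in porbit (face G) (Centre v) ->
     porbit (node G) a != porbit (node G) b) ->
  forall a, a \in porbit (face F) d -> porbit (node F) a != porbit (node F) v.
Proof.
move=> dv a ad; apply/negP; rewrite eq_porbit_mem => av.
have /eqP[] : porbit (node G) (Spoke (face F a)) != porbit (node G) (Centre a).
  apply: dv; first by rewrite face_orbit_Spoke imset_f // -eq_porbit_mem porbitS eq_porbit_mem.
  rewrite -eq_porbit_mem; apply/eqP.
  apply: (porbit_invariant (g := fun z => porbit (face G) (Centre z)) _ av) => z.
  by rewrite -[RHS]porbitS face_Centre -[RHS]porbitS face_Old edgeK.
by rewrite -node_Spoke porbitS.
Qed.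

Section TwoHexagons.
Hypothesis cubF : cubic F.
Hypothesis dualF : forall c d : dart F,
  d \in porbit (face F) c -> edge F d \in porbit (face F) (edge F c) -> c = d.
Hypothesis longF : forall d : dart F, 4 < #|porbit (face F) d|.

(** The alternative of equal faces serves patterns made of one hexagon. *)
Lemma leapfrog_two_hexagons (x y : dart G) : hex x -> hex y ->
  porbit (face G) x = porbit (face G) y \/
    (forall a b, a \in porbit (face G) x -> b \in porbit (face G) y ->
       porbit (node G) a != porbit (node G) b) ->
  exists s : pred (dart F), [/\ forall d, s (node F d) = s d, independent s,
    alternates (switched s) x & alternates (switched s) y].
Proof.
rewrite /hex /alternates.
have [[d ->]|[v ->]] := dart_kind x; have [[d' ->]|[v' ->]] := dart_kind y => hx hy xy.
- have [s [sN sI sx sy]] := two_hexagons cubF dualF longF (hex_Spoke hx) (hex_Spoke hy).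
  by exists s; split=> //; apply: switched_Spoke.
- case: xy => [xy|/Spoke_Centre_vertex off].
    have := porbit_id (face G) (Centre v').
    by rewrite -xy face_orbit_Spoke => /imsetP[].
  have [s [sN sI sx sv]] := hexagon_off_vertex cubF dualF longF (hex_Spoke hx) off.
  by exists s; split=> //; [apply: switched_Spoke | apply: switched_Centre].
- case: xy => [xy|off].
    have := porbit_id (face G) (Centre v).
    by rewrite xy face_orbit_Spoke => /imsetP[].
  have {}off := Spoke_Centre_vertex (fun a b ad bv => contra_neq esym (off b a bv ad)).
  have [s [sN sI sy sv]] := hexagon_off_vertex cubF dualF longF (hex_Spoke hy) off.
  by exists s; split=> //; [apply: switched_Centre | apply: switched_Spoke].
(* Around vertices of [F] the unswitched matching already alternates. *)
- by exists pred0; split=> //; apply: switched_Centre.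
Qed.

End TwoHexagons.

End Leapfrog.

(** The switched matching is pulled back along [psi], which carries orbits to orbits. *)
Lemma resonant_of_switched (G F : cmap) (psi : dart G -> dart (leapfrog F))
    (s : pred (dart F)) (H : {set {set dart G}}) :
  injective psi ->
  (forall x, psi (edge G x) = edge (leapfrog F) (psi x)) ->
  (forall x, psi (node G x) = node (leapfrog F) (psi x)) ->
  (forall d, s (node F d) = s d) -> independent s ->
  (forall h, h \in H -> exists2 x, h = porbit (face G) x & alternates (switched s) (psi x)) ->
  resonant_pattern H.
Proof.
move=> psi_inj psiE psiN sN sI sH.
have psiF x : psi (face G x) = face (leapfrog F) (psi x).
  by apply: (@perm_inj _ (node (leapfrog F))); rewrite -psiN !node_face psiE.
pose m x := switched s (psi x).
have mE x : m (edge G x) = m x by rewrite /m psiE switched_edge.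
have m_ex x : exists2 y, y \in porbit (node G) x & m y.
  have [z] := switched_ex sN (psi x).
  by rewrite (porbit_conj _ psiN) => /imsetP[y yx ->] my; exists y.
have m_uniq x y : y \in porbit (node G) x -> m x -> m y -> x = y.
  move=> yx mx my; apply: psi_inj; apply: (switched_uniq sN sI) mx my.
  by rewrite (porbit_conj _ psiN) imset_f.
exists (matching_of m); split; first exact: matching_of_perfect.
move=> h /sH[x -> sx] d dx; rewrite !mem_matching_of //.
have := sx (psi d); rewrite (porbit_conj _ psiF) imset_f // => /(_ isT).
by rewrite -psiF /m; do 2!case: (switched s _).
Qed.

Theorem theorem3p2 (G : cmap) (hG : leapfrog_fullerene G) : k_resonant G 2.
Proof.
have [_ [F [[smpF plF conF cubF [_ faceF]]]]] := hG.
move=> [phi [[psi phiK psiK] phiE phiN]].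
have psiE x : psi (edge G x) = edge (leapfrog F) (psi x) by rewrite -{1}[x]psiK -phiE phiK.
have psiN x : psi (node G x) = node (leapfrog F) (psi x) by rewrite -{1}[x]psiK -phiN phiK.
have psi_inj := can_inj psiK.
have psiF x : psi (face G x) = face (leapfrog F) (psi x).
  by apply: (@perm_inj _ (node (leapfrog F))); rewrite -psiN !node_face psiE.
have longF (d : dart F) : 4 < #|porbit (face F) d|.
  have dF : porbit (face F) d \in faces F by apply: imset_f.
  by have [] := faceF _ dF => ->.
have dualF := dual_simple smpF plF conF cubF.
move=> i H i2 Hhex Hi Hdisj.
(* A nonempty pattern is treated as a pair of faces, a single hexagon being paired with itself. *)
have [->|[x [y [xH yH HE]]]] : H = set0 \/ exists x y, [/\ porbit (face G) x \in H,
    porbit (face G) y \in H & H = [set porbit (face G) x; porbit (face G) y]].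
  have Hface h : h \in H -> exists x, h = porbit (face G) x.
    by move=> /(subsetP Hhex); rewrite inE => /andP[/imsetP[x _ ->] _]; exists x.
  case: i i2 Hi => [|[|[|//]]] _ /eqP.
  - by rewrite cards_eq0 => /eqP->; left.
  - move=> /cards1P[h HE]; right; have [|x hE] := Hface h; first by rewrite HE set11.
    by exists x, x; rewrite -hE setUid HE set11.
  - case/cards2P=> h [h' [_ HE]]; right.
    have [|x hE] := Hface h; first by rewrite HE set21.
    have [|y h'E] := Hface h'; first by rewrite HE set22.
    by exists x, y; rewrite -hE -h'E HE set21 set22.
  apply: (resonant_of_switched (s := pred0)) psi_inj psiE psiN _ _ _ => // h.
  by rewrite inE.
have hexH x' : porbit (face G) x' \in H -> hex (psi x').
  move=> /(subsetP Hhex); rewrite inE => /andP[_ /eqP].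
  by rewrite /hex (porbit_conj _ psiF) card_imset.
have [|s [sN sI sx sy]] :=
    leapfrog_two_hexagons cubF dualF longF (hexH x xH) (hexH y yH).
  rewrite !(porbit_conj _ psiF); have [->|xy] := eqVneq (porbit (face G) x) (porbit (face G) y).
    by left.
  right=> _ _ /imsetP[a ax ->] /imsetP[b bY ->].
  rewrite !(porbit_conj _ psiN) (inj_eq (imset_inj psi_inj)); apply/eqP => ab.
  have /pred0P/(_ (porbit (node G) a)) := Hdisj _ _ xH yH xy.
  by rewrite /= imset_f // ab imset_f.
apply: (resonant_of_switched psi_inj psiE psiN sN sI) => h.
by rewrite HE => /set2P[]->; [exists x | exists y].
Qed.
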